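(* Let $\mathcal{R}$ be a commutative ring and let $a,b,c,d\in\mathcal{R}$. The module $\mathcal{F}^{[2]}\big((a,b)\otimes(c,d)\big)$ is a free $\mathcal{R}$-module of rank $4$. In general, for $\mathcal{R}$-modules $\mathbf{M},\mathbf{N}$, the $\mathcal{R}$-module $\mathcal{F}^{[2]}_{\mathbf{M}\otimes\mathbf{N}}\big((a,b)\otimes(c,d)\big)$ is isomorphic to $(\mathbf{M}\otimes_{\mathcal{R}}\mathbf{N})^{4}$.
   Context: For an $\mathcal{R}$-module $\mathbf{L}$, $\mathcal{F}^{[2]}_{\mathbf{L}}((a,b)\otimes(c,d))$ is the $\mathcal{R}$-module (under termwise operations) of double sequences $(x_{n,k})_{n,k\ge0}$ with $x_{n,k}\in\mathbf{L}$ such that for all $n,k\ge0$ $$x_{n+2,k}=a x_{n+1,k}+b x_{n,k},\qquad x_{n,k+2}=c x_{n,k+1}+d x_{n,k}.$$ When $\mathbf{L}=\mathcal{R}$ the subscript is omitted. *)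

(* Defs.v *)
From HB Require Import structures.
From mathcomp Require Import all_boot all_algebra.
From mathcomp Require Import generic_quotient ring_quotient.
From mathcomp Require Import boolp classical_sets functions cardinality.

Set Implicit Arguments.
Unset Strict Implicit.
Unset Printing Implicit Defensive.

Import GRing.Theory.
Local Open Scope ring_scope.
Local Open Scope classical_set_scope.
Local Open Scope quotient_scope.

Section DoubleSequences.
Context {R : comPzRingType} (L : lmodType R) (a b c d : R).

Definition double_linrec (x : nat -> nat -> L) : bool :=
  `[< forall n k : nat,
        x n.+2 k = a *: x n.+1 k + b *: x n k /\
        x n k.+2 = c *: x n k.+1 + d *: x n k >].

Record F2 := MkF2 {
  F2_val :> nat -> nat -> L;
  F2P : double_linrec F2_val
}.

HB.instance Definition _ := [isSub for F2_val].
HB.instance Definition _ := [Choice of F2 by <:].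

Lemma double_linrec_submod_closed : submod_closed double_linrec.
Proof.
split=> [|r x y /asboolP hx /asboolP hy]; apply/asboolP => n k.
  by split; rewrite !scaler0 addr0.
by have [hx1 hx2] := hx n k; have [hy1 hy2] := hy n k; split;
  rewrite -[LHS]/(r *: x _ _ + y _ _) ?hx1 ?hx2 ?hy1 ?hy2;
  rewrite -![(r *: x + y) _ _]/(r *: x _ _ + y _ _) !scalerDr !scalerA;
  rewrite ![_ * r]mulrC addrACA.
Qed.

HB.instance Definition _ :=
  GRing.isSubmodClosed.Build R (nat -> nat -> L) double_linrec
    double_linrec_submod_closed.
HB.instance Definition _ := [SubChoice_isSubLmodule of F2 by <:].

End DoubleSequences.

Definition is_basis (R : comPzRingType) (V : lmodType R) (n : nat)
    (e : 'I_n -> V) : Prop :=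
  (forall r : 'I_n -> R, \sum_i r i *: e i = 0 -> forall i, r i = 0) /\
  (forall v : V, exists r : 'I_n -> R, v = \sum_i r i *: e i).

Definition free_of_rank (R : comPzRingType) (n : nat) (V : lmodType R) : Prop :=
  exists e : 'I_n -> V, is_basis e.

Definition isomorphic (R : comPzRingType) (V W : lmodType R) : Prop :=
  exists f : {linear V -> W}, bijective f.

(* The tensor product of modules over a commutative ring is not in the
   libraries. It is built here as the quotient of the free module on M * N
   (finitely supported functions M * N -> R) by the submodule spanned by the
   bilinearity relations. *)

Section FreeModule.
Context (R : comPzRingType) (I : choiceType).

Definition finite_support (f : I -> R^o) : bool :=
  `[< finite_set [set i | f i != 0] >].

Record free_module := MkFree {
  free_val :> I -> R^o;
  free_valP : finite_support free_val
}.

HB.instance Definition _ := [isSub for free_val].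
HB.instance Definition _ := [Choice of free_module by <:].

Lemma finite_support_submod_closed : submod_closed finite_support.
Proof.
split=> [|r x y /asboolP hx /asboolP hy]; apply/asboolP.
  by apply: (sub_finite_set _ (finite_set0 I)) => i /=; rewrite eqxx.
apply: (@sub_finite_set _ _ ([set i | x i != 0] `|` [set i | y i != 0])).
  move=> i /=; have [x0|?] := eqVneq (x i) 0; last by left.
  have [y0|?] := eqVneq (y i) 0; last by right.
  by rewrite -[X in X != 0]/(r *: x i + y i) x0 y0 scaler0 addr0 eqxx.
by rewrite finite_setU.
Qed.

HB.instance Definition _ :=
  GRing.isSubmodClosed.Build R (I -> R^o) finite_support
    finite_support_submod_closed.
HB.instance Definition _ := [SubChoice_isSubLmodule of free_module by <:].

Lemma finite_support_unit (i : I) :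
  finite_support (fun j => (j == i)%:R : R^o).
Proof.
apply/asboolP; apply: (sub_finite_set _ (finite_set1 i)) => j /=.
by have [->|] := eqVneq j i => //; rewrite eqxx.
Qed.

Definition free_unit (i : I) : free_module := MkFree (finite_support_unit i).

End FreeModule.

Arguments free_unit R {I} i.

Section QuotientModule.
Context (R : comPzRingType) (V : lmodType R) (G : set V).

Inductive span : V -> Prop :=
| span0 : span 0
| span_step (r : R) (g v : V) : G g -> span v -> span (r *: g + v).

Definition span_mem (v : V) : bool := `[< span v >].

Lemma span_mem_submod_closed : submod_closed span_mem.
Proof.
split=> [|r x y /asboolP hx /asboolP hy]; apply/asboolP; first exact: span0.
elim: hx => [|s g v Gg _ IH]; first by rewrite scaler0 add0r.
by rewrite scalerDr scalerA -addrA; exact: span_step.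
Qed.

HB.instance Definition _ :=
  GRing.isSubmodClosed.Build R V span_mem span_mem_submod_closed.

Definition quot_module : Type :=
  Quotient.quot (GRing.ZmodClosed.clone V span_mem _).

HB.instance Definition _ := ZmodQuotient.on quot_module.

(* Quotient.quot is only a quotient of abelian groups, so the scalar action
   has to be added. *)
Definition quot_scale (r : R) (u : quot_module) : quot_module :=
  \pi_quot_module (r *: repr u).

Lemma pi_scale (r : R) (v : V) :
  \pi_quot_module (r *: v) = quot_scale r (\pi_quot_module v).
Proof.
have : v - repr (\pi_quot_module v) \in span_mem.
  by rewrite (Quotient.idealrBE (GRing.ZmodClosed.clone V span_mem _)) reprK.
move=> /(rpredZ r); rewrite scalerBr.
by rewrite (Quotient.idealrBE (GRing.ZmodClosed.clone V span_mem _)) => /eqP.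
Qed.

Lemma quot_scaleA r s u : quot_scale r (quot_scale s u) = quot_scale (r * s) u.
Proof.
elim/quotW: u => x.
by rewrite -[quot_scale s _]pi_scale -[LHS]pi_scale -[RHS]pi_scale scalerA.
Qed.

Lemma quot_scale1 : left_id 1 quot_scale.
Proof. by elim/quotW => x; rewrite -pi_scale scale1r. Qed.

Lemma quot_scaleDr : right_distributive quot_scale +%R.
Proof.
move=> r; elim/quotW => x; elim/quotW => y.
by rewrite -raddfD -!pi_scale scalerDr raddfD.
Qed.

Lemma quot_scaleDl u : {morph quot_scale^~ u : r s / r + s}.
Proof.
by elim/quotW: u => x r s; rewrite -!pi_scale scalerDl raddfD.
Qed.

HB.instance Definition _ :=
  GRing.Zmodule_isLmodule.Build R quot_module
    quot_scaleA quot_scale1 quot_scaleDr quot_scaleDl.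

End QuotientModule.

Section TensorProduct.
Context (R : comPzRingType) (M N : lmodType R).

Local Notation "[ m , n ]" := (free_unit R (m : M, n : N)).

Inductive bilinear_relation : free_module R (M * N)%type -> Prop :=
| rel_addl (m m' : M) (n : N) :
    bilinear_relation ([m + m', n] - [m, n] - [m', n])
| rel_addr (m : M) (n n' : N) :
    bilinear_relation ([m, n + n'] - [m, n] - [m, n'])
| rel_scalel (r : R) (m : M) (n : N) :
    bilinear_relation ([r *: m, n] - r *: [m, n])
| rel_scaler (r : R) (m : M) (n : N) :
    bilinear_relation ([m, r *: n] - r *: [m, n]).

Definition tensor : Type := quot_module bilinear_relation.

HB.instance Definition _ := GRing.Lmodule.on tensor.

End TensorProduct.

(* Main.v *)
(** A sequence satisfying [x_(n+2) = a x_(n+1) + b x_n] is determined by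
    [x_0, x_1], which are arbitrary, and depends linearly on them. Applying this
    in both indices, a double sequence is determined by its four values at
    [(n, k)] with [n, k < 2]; and extending such values first along [k], then
    along [n], preserves the recurrence in [k] by linearity. So [F2 L] is
    isomorphic to [L ^ 4] for every module [L], in particular for a tensor
    product. *)
From HB Require Import structures.
Require Import Defs.
From mathcomp Require Import all_boot all_algebra.
From mathcomp Require Import boolp.

Set Implicit Arguments.
Unset Strict Implicit.
Unset Printing Implicit Defensive.

Import GRing.Theory.
Local Open Scope ring_scope.

Section LinearRecurrence.
Context {R : comPzRingType} {L : lmodType R} (a b : R).
Implicit Types (u v : L) (x : nat -> L).

(** Sliding the pair of initial values keeps the recursion one-step, so plain induction on [n], with
    the initial values generalized, suffices below. *)
Fixpoint linrec u v (n : nat) : L :=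
  if n is n'.+1 then linrec v (a *: v + b *: u) n' else u.

Lemma linrecSS u v n :
  linrec u v n.+2 = a *: linrec u v n.+1 + b *: linrec u v n.
Proof. by elim: n u v => [//|n IH] u v; exact: IH. Qed.

Lemma linrec_linear r s u u' v v' n :
  linrec (r *: u + s *: u') (r *: v + s *: v') n =
  r *: linrec u v n + s *: linrec u' v' n.
Proof.
elim: n u u' v v' => [//|n IH] u u' v v' /=.
rewrite -IH; congr linrec.
by rewrite !scalerDr !scalerA ![_ * a]mulrC ![_ * b]mulrC addrACA.
Qed.

Lemma linrec_unique x :
  (forall n, x n.+2 = a *: x n.+1 + b *: x n) -> x =1 linrec (x 0) (x 1).
Proof.
move=> xSS n; elim: n x xSS => [//|n IH] x xSS /=.
(* The shifted sequence obeys the same recurrence and starts with [x 1], [x 2]. *)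
by rewrite -xSS (IH (fun m => x m.+1)) // => m; rewrite xSS.
Qed.

End LinearRecurrence.

Section DoubleRecurrence.
Context {R : comPzRingType} {L : lmodType R} (a b c d : R).
Local Notation F2 := (F2 L a b c d).
Implicit Types (x : F2) (f : {ffun 'I_4 -> L}).

Lemma F2_SSl x n k : x n.+2 k = a *: x n.+1 k + b *: x n k.
Proof. by have /asboolP/(_ n k)[] := F2P x. Qed.

Lemma F2_SSr x n k : x n k.+2 = c *: x n k.+1 + d *: x n k.
Proof. by have /asboolP/(_ n k)[] := F2P x. Qed.

Definition initial_values x : {ffun 'I_4 -> L} :=
  [ffun i : 'I_4 => x (i %/ 2)%N (i %% 2)%N].

Lemma initial_values_linear : linear initial_values.
Proof. by move=> r x y; apply/ffunP => i; rewrite !ffunE. Qed.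

HB.instance Definition _ :=
  GRing.isLinear.Build R F2 {ffun 'I_4 -> L} _ initial_values
    initial_values_linear.

(** Entry [2 * n + k] of [f] stands for position [(n, k)]: entries 0 and 1 start row 0, entries 2
    and 3 start row 1. *)
Definition extend_seq f (n k : nat) : L :=
  linrec a b (linrec c d (f (inord 0)) (f (inord 1)) k)
             (linrec c d (f (inord 2)) (f (inord 3)) k) n.

Lemma extend_seqP f : double_linrec a b c d (extend_seq f).
Proof.
apply/asboolP => n k; split; first exact: linrecSS.
by rewrite /extend_seq !(linrecSS c d) linrec_linear.
Qed.

Definition extend f : F2 := MkF2 (extend_seqP f).

Lemma initial_valuesK : cancel initial_values extend.
Proof.
move=> x; apply/val_inj/funext => n; apply/funext => k /=.
(* Uniqueness along [n] at fixed [k] reduces the claim to rows 0 and 1, where uniqueness along [k]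
   applies. *)
rewrite /extend_seq !ffunE !inordK // [RHS](linrec_unique (F2_SSl x ^~ k)).
by congr linrec; rewrite [RHS](linrec_unique (F2_SSr x _)).
Qed.

Lemma extendK : cancel extend initial_values.
Proof.
move=> f; apply/ffunP => i; rewrite ffunE /= /extend_seq.
by case: i => [[|[|[|[|//]]]] lti] /=; congr (f _); apply/val_inj;
  rewrite /= inordK.
Qed.

Lemma F2_isomorphic : isomorphic F2 {ffun 'I_4 -> L}.
Proof.
exists initial_values; exists extend.
- exact: initial_valuesK.
- exact: extendK.
Qed.

End DoubleRecurrence.

Lemma isomorphic_free_of_rank (R : comPzRingType) (V : lmodType R) (n : nat) :
  isomorphic V {ffun 'I_n -> R^o} -> free_of_rank n V.
Proof.
move=> [f [g fK gK]].
pose e i := g [ffun j => (j == i)%:R].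
(* Only [f] is given as linear, so combinations of the preimages [e] of the standard basis are
   compared through their images: this yields independence and, as [f] is injective, spanning. *)
have fE (r : 'I_n -> R) i : f (\sum_j r j *: e j) i = r i.
  rewrite raddf_sum sum_ffunE (bigD1 i) //= big1 => [|j /negPf ji].
    by rewrite linearZ /= gK !ffunE eqxx addr0 [LHS]mulr1.
  by rewrite linearZ /= gK !ffunE eq_sym ji scaler0.
exists e; split=> [r r0 i|v]; first by rewrite -fE r0 raddf0 ffunE.
by exists (f v); apply/(can_inj fK)/ffunP => i; rewrite fE.
Qed.

Theorem corollary1p8 (R : comPzRingType) (a b c d : R) :
  free_of_rank 4 (F2 R^o a b c d) /\
  forall M N : lmodType R,
    isomorphic (F2 (tensor M N) a b c d) {ffun 'I_4 -> tensor M N}.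
Proof.
by split=> [|M N]; [apply: isomorphic_free_of_rank|]; exact: F2_isomorphic.
Qed.
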